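(* For every integer $k\ge 1$, the choice index (list chromatic index) of the generalised Petersen graph $GP(3k,k)$ equals its chromatic index; that is, the list-colouring conjecture holds for $GP(3k,k)$.
   Context: For integers $n,k$ with $1\le k<n/2$, the generalised Petersen graph $GP(n,k)$ has vertex set $\{u_i,v_i : i\in\mathbb{Z}_n\}$ and edge set $\{u_iu_{i+1},\ u_iv_i,\ v_iv_{i+k} : i\in\mathbb{Z}_n\}$. The chromatic index of a graph is the least number of colours in a proper edge colouring. The choice index is the least $\ell$ such that for every assignment of lists $L_e$ of $\ell$ colours to the edges $e$, there is a proper edge colouring in which every edge $e$ receives a colour from $L_e$. *)

(* Defs.v *)
From mathcomp Require Import all_boot.
Set Implicit Arguments. Unset Strict Implicit. Unset Printing Implicit Defensive.

Record graph := Graph { gV : finType; gadj : rel gV }.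

(* Vertices of GP(n,k): (false, i) is u_i and (true, i) is v_i, i in Z_n. *)
Definition GPV (n : nat) : finType := (bool * 'I_n)%type.

Definition GPadj (n k : nat) : rel (GPV n) := fun x y =>
  let: (b, i) := x in let: (b', j) := y in
  [|| [&& ~~ b, ~~ b' & ((j == (i + 1) %% n :> nat) || (i == (j + 1) %% n :> nat))],
      [&& b != b' & (i == j :> nat)]
    | [&& b, b' & ((j == (i + k) %% n :> nat) || (i == (j + k) %% n :> nat))]].

Definition GP (n k : nat) : graph := @Graph (GPV n) (@GPadj n k).

Definition is_edge (G : graph) (e : {set gV G}) : bool :=
  [exists x, exists y, gadj x y && (e == [set x; y])].

Definition edge (G : graph) : finType := {e : {set gV G} | is_edge e}.

Definition proper_edge_colouring (G : graph) (c : edge G -> nat) : Prop :=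
  forall e f : edge G, e != f -> (val e :&: val f != set0) -> c e != c f.

Definition edge_colourable (G : graph) (l : nat) : Prop :=
  exists c : edge G -> nat, proper_edge_colouring c /\ forall e, c e < l.

Definition edge_choosable (G : graph) (l : nat) : Prop :=
  forall L : edge G -> seq nat, (forall e, uniq (L e) /\ size (L e) = l) ->
  exists c : edge G -> nat, proper_edge_colouring c /\ forall e, c e \in L e.

Definition is_chromatic_index (G : graph) (l : nat) : Prop :=
  edge_colourable G l /\ forall m, edge_colourable G m -> l <= m.

Definition is_choice_index (G : graph) (l : nat) : Prop :=
  edge_choosable G l /\ forall m, edge_choosable G m -> l <= m.

(* Main.v *)
Require Import Defs.
From mathcomp Require Import all_boot all_order all_algebra ring zify.
Set Implicit Arguments. Unset Strict Implicit. Unset Printing Implicit Defensive.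
Import GRing.Theory Num.Theory.

(* The chromatic index is at least 3 because GP(3k,k) is cubic, so everything reduces to
   3-edge-choosability, proved by the Combinatorial Nullstellensatz. The graph polynomial of
   the line graph, a product over the vertices of 3-variable Vandermonde polynomials, is
   homogeneous of degree 2|E|, and list colourings exist as soon as the coefficient of
   [\prod_e x e ^+ 2] is nonzero. Up to a nonzero factor this coefficient is a weighted sum of
   the polynomial over lists of size 3, whichever lists are used; with all lists equal to
   {0,1,2} it is a signed count of the proper 3-edge-colourings.
   Arranging the indices [r * k + j] in 3 rows and k columns, the signed count becomes the
   trace of [K ^+ k] twisted by a cyclic shift of the rows, where the 27 x 27 transfer matrix K
   acts on the colours of the three outer edges between consecutive columns. Since
   K^3 = -192 K, the twisted trace is nonzero for all k once it is for k = 1 and k = 2. *)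

(** * Indexing the edges of GP(n,k) *)

(* [(None, i)] is the spoke [u_i v_i]; [(Some b, i)] is the rim edge joining [(b, i)] to
   [(b, i + step k b)]. *)
Definition edge_index (n : nat) : finType := (option bool * 'I_n)%type.

Definition step (k : nat) (b : bool) : nat := if b then k else 1.

(** Addition modulo [n]; the positivity of [n] comes from [i] itself, so [n] can be any term such as
    [3 * k]. *)
Definition ordD (n : nat) (i : 'I_n) (s : nat) : 'I_n :=
  Ordinal (ltn_pmod (i + s) (leq_ltn_trans (leq0n i) (ltn_ord i))).

Lemma ordDK (n s : nat) (i : 'I_n) : s <= n -> ordD (ordD i s) (n - s) = i.
Proof.
move=> sn; apply: val_inj; rewrite /= modnDml.
by rewrite -addnA subnKC // modnDr modn_small.
Qed.

Lemma ordDKV (n s : nat) (i : 'I_n) : s <= n -> ordD (ordD i (n - s)) s = i.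
Proof.
move=> sn; apply: val_inj; rewrite /= modnDml.
by rewrite -addnA subnK // modnDr modn_small.
Qed.

Definition edge_set (n k : nat) (e : edge_index n) : {set GPV n} :=
  if e.1 is Some b then [set (b, e.2); (b, ordD e.2 (step k b))]
  else [set (false, e.2); (true, e.2)].

(** Subtraction of the step modulo [n] is addition of [n - step]. The order spoke, leaving rim edge,
    entering rim edge is also that of the arguments of the vertex factors below, whose signs depend
    on it. *)
Definition incident (n k : nat) (x : GPV n) : seq (edge_index n) :=
  [:: (None, x.2); (Some x.1, x.2); (Some x.1, ordD x.2 (n - step k x.1))].

Lemma edge_set_is_edge (n k : nat) (e : edge_index n) : is_edge (G := GP n k) (edge_set k e).
Proof.
case: e => [[b|] i]; apply/existsP.
  exists (b, i); apply/existsP; exists (b, ordD i (step k b)).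
  by rewrite eqxx andbT /=; case: b; rewrite /= eqxx.
exists (false, i); apply/existsP; exists (true, i).
by rewrite /= !eqxx.
Qed.

Lemma edge_set_surj (n k : nat) (e : edge (GP n k)) : exists i, edge_set k i = val e.
Proof.
case: e => /= e /existsP[[b i] /existsP[[b' j] /andP[]]].
case/or3P=> [/and3P[]|/andP[bb /eqP/val_inj ij]|/and3P[]].
- case: b b' => [] [] //= _ _ /orP[]/eqP E /eqP->.
    exists (Some false, i); rewrite /edge_set /=; congr [set _; (_, _)].
    exact: val_inj.
  exists (Some false, j); rewrite setUC /edge_set /=; congr [set _; (_, _)].
  exact: val_inj.
- subst j => /eqP->; exists (None, i).
  by case: b b' bb => [] [] //= _; rewrite /edge_set //= setUC.
- case: b b' => [] [] //= _ _ /orP[]/eqP E /eqP->.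
    exists (Some true, i); rewrite /edge_set /=; congr [set _; (_, _)].
    exact: val_inj.
  exists (Some true, j); rewrite setUC /edge_set /=; congr [set _; (_, _)].
  exact: val_inj.
Qed.

Lemma mem_edge_set (n k : nat) (x : GPV n) (e : edge_index n) :
  1 <= k <= n -> x \in edge_set k e -> e \in incident k x.
Proof.
case: x e => b i [[b'|] j] /andP[k1 kn]; rewrite /edge_set !inE /= !xpair_eqE /=.
  case/orP=> /andP[/eqP-> /eqP->]; rewrite ?eqxx ?orbT //.
  by rewrite ordDK ?eqxx ?orbT //; case: (b') => /=; lia.
by case/orP=> /andP[_ /eqP->]; rewrite eqxx.
Qed.

(** Passes from edges as vertex sets to indices: lists are pulled back along the surjective map
    [mk], and an edge takes the colour of a chosen preimage. Two edges meeting at [x] have preimages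
    in [incident k x]. *)
Lemma GP_edge_choosable (n k l : nat) : 1 <= k <= n ->
  (forall L : edge_index n -> seq nat, (forall e, uniq (L e) /\ size (L e) = l) ->
    exists c : edge_index n -> nat, (forall e, c e \in L e) /\
      forall x : GPV n, uniq [seq c e | e <- incident k x]) ->
  edge_choosable (GP n k) l.
Proof.
move=> kn chooseL L Lu.
pose mk (i : edge_index n) : edge (GP n k) := Sub (edge_set k i) (edge_set_is_edge k i).
have [c [cL cu]] := chooseL (fun i => L (mk i)) (fun i => Lu (mk i)).
have mk_surj e : exists i, mk i == e.
  by have [i ie] := edge_set_surj e; exists i; rewrite -val_eqE /= ie.
pose idx e := xchoose (mk_surj e).
have idxK e : mk (idx e) = e by apply/eqP/(xchooseP (mk_surj e)).
exists (fun e => c (idx e)); split=> [e f ef|e]; last by rewrite -{2}(idxK e).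
case/set0Pn=> x; rewrite !inE => /andP[xe xf].
have inc (g : edge (GP n k)) : x \in val g -> idx g \in incident k x.
  by rewrite -{1}(idxK g); apply: mem_edge_set.
have ne : idx e != idx f by apply: contra_neq ef => /(congr1 mk); rewrite !idxK.
have := cu x.
move: (inc e xe) (inc f xf) ne; rewrite !inE.
by do 2![case/or3P=> /eqP->]; rewrite ?eqxx //= !inE !negb_or andbT
  => _ /andP[/andP[? ?] ?] //; rewrite eq_sym.
Qed.

Lemma edge_choosable_colourable (G : graph) (l : nat) :
  edge_choosable G l -> edge_colourable G l.
Proof.
case/(_ (fun=> iota 0 l)) => [e|c [cp cl]]; first by rewrite iota_uniq size_iota.
by exists c; split=> // e; have := cl e; rewrite mem_iota.
Qed.

Lemma GP_edge_colourable_ge3 (n k l : nat) : 2 < n -> edge_colourable (GP n k) l -> 2 < l.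
Proof.
move=> n3 [c [cp cl]].
have n0 : 0 < n by lia.
pose o := Ordinal n0.
pose mk (i : edge_index n) : edge (GP n k) := Sub (edge_set k i) (edge_set_is_edge k i).
pose s := [seq mk i | i <- incident k (false, o)].
have o_in e : e \in s -> (false, o) \in val e.
  by rewrite !inE => /or3P[]/eqP->; rewrite /= !inE /= ?eqxx ?orbT // ordDKV ?eqxx ?orbT //=; lia.
have su : uniq s.
  have v1 : 1 %% n = 1 by rewrite modn_small //; lia.
  have v2 : (n - 1) %% n = n - 1 by rewrite modn_small //; lia.
  have ne (A B : {set GPV n}) x : x \in A -> x \notin B -> A != B.
    by move=> xA; apply: contraNneq => <-.
  rewrite /= !inE !negb_or -!val_eqE /= andbT; apply/andP; split; first (apply/andP; split).
  - by apply: (ne _ _ (true, o)); rewrite !inE ?eqxx ?orbT.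
  - by apply: (ne _ _ (true, o)); rewrite !inE ?eqxx ?orbT.
  (* The neighbour [u_1] separates the two rim edges at [u_0], since [1 <> n - 1] for [n > 2]. *)
  - apply: (ne _ _ (false, ordD o 1)); rewrite !inE ?eqxx ?orbT //= !xpair_eqE /= -!val_eqE /=.
    rewrite !add0n v2 v1 subnK ?modnn //; lia.
have csu : uniq (map c s).
  rewrite map_inj_in_uniq // => e f /o_in oe /o_in of_; apply: contra_eq => ef.
  apply: cp => //; apply/set0Pn; exists (false, o); rewrite inE oe; exact: of_.
have /(uniq_leq_size csu) : {subset map c s <= iota 0 l}.
  by move=> _ /mapP[e _ ->]; rewrite mem_iota cl.
by rewrite size_iota.
Qed.

Local Open Scope ring_scope.

(** * Homogeneous polynomial functions and the Combinatorial Nullstellensatz *)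

Definition homogeneous (F : fieldType) (E : finType) (d : nat)
    (P : (E -> F) -> F) : Prop :=
  exists2 s : seq (F * {ffun E -> nat}),
    all (fun t : F * {ffun E -> nat} => (\sum_e t.2 e == d)%N) s
    & forall x, P x = \sum_(t <- s) t.1 * \prod_e x e ^+ t.2 e.

Lemma homogeneous1 (F : fieldType) (E : finType) :
  homogeneous 0 (fun _ : E -> F => 1).
Proof.
exists [:: (1, [ffun=> 0%N])] => [|x] /=.
  by rewrite andbT big1 // => e _; rewrite ffunE.
by rewrite big_seq1 /= mul1r big1 // => e _; rewrite ffunE.
Qed.

Lemma homogeneous_var (F : fieldType) (E : finType) (e : E) :
  homogeneous 1 (fun x : E -> F => x e).
Proof.
exists [:: (1, [ffun e' => (e' == e) : nat])] => [|x] /=.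
  rewrite andbT (bigD1 e) //= ffunE eqxx big1 // => e' ne.
  by rewrite ffunE (negbTE ne).
rewrite big_seq1 /= mul1r (bigD1 e) //= ffunE eqxx big1 ?mulr1 // => e' ne.
by rewrite ffunE (negbTE ne).
Qed.

Lemma homogeneousB (F : fieldType) (E : finType) (d : nat)
    (P Q : (E -> F) -> F) :
  homogeneous d P -> homogeneous d Q -> homogeneous d (fun x => P x - Q x).
Proof.
move=> [s sd Ps] [t td Qt].
exists (s ++ [seq (- u.1, u.2) | u <- t]) => [|x].
  by rewrite all_cat sd all_map.
rewrite big_cat big_map Ps Qt /= -sumrN; congr (_ + _).
by apply: eq_bigr => u _; rewrite mulNr.
Qed.

Lemma homogeneousM (F : fieldType) (E : finType) (d d' : nat)
    (P Q : (E -> F) -> F) :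
  homogeneous d P -> homogeneous d' Q ->
  homogeneous (d + d') (fun x => P x * Q x).
Proof.
move=> [s sd Ps] [t td Qt].
exists [seq (u.1 * v.1, [ffun e => (u.2 e + v.2 e)%N]) |
    u : F * {ffun E -> nat} <- s, v : F * {ffun E -> nat} <- t].
  apply/allP => _ /allpairsP[[u v] /= [us vt ->]] /=.
  under eq_bigr do rewrite ffunE.
  by rewrite big_split (eqP (allP sd _ us)) (eqP (allP td _ vt)).
move=> x; rewrite big_allpairs_dep Ps Qt mulr_suml.
apply: eq_bigr => u _; rewrite mulr_sumr; apply: eq_bigr => v _ /=.
under [in RHS]eq_bigr do rewrite ffunE exprD.
by rewrite big_split /= mulrACA.
Qed.

Lemma homogeneous_prod (F : fieldType) (E I : finType) (d : nat)
    (P : I -> (E -> F) -> F) :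
  (forall i, homogeneous d (P i)) ->
  homogeneous (#|I| * d) (fun x => \prod_i P i x).
Proof.
move=> Pd; rewrite -sum_nat_const.
have: forall r : seq I,
  homogeneous (\sum_(i <- r) d) (fun x => \prod_(i <- r) P i x).
  elim=> [|i r IHr].
    have [s sd Ps] := homogeneous1 F E; exists s; first by rewrite big_nil.
    by move=> x; rewrite big_nil -(Ps x).
  have [s sd Ps] := homogeneousM (Pd i) IHr; exists s; first by rewrite big_cons.
  by move=> x; rewrite big_cons -(Ps x).
exact.
Qed.

(* Expanding into monomials makes the sum factor over [E]; by homogeneity,
   every monomial other than [\prod_e x e ^+ l] has an exponent below [l]. *)
Lemma homogeneous_weighted_sum (F : fieldType) (E : finType) (l : nat)
    (P : (E -> F) -> F) : homogeneous (#|E| * l) P ->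
  exists K : F, forall (J : finType) (x w : E -> J -> F),
    (forall e m, (m < l)%N -> \sum_j w e j * x e j ^+ m = 0) ->
    \sum_(g : {ffun E -> J}) (\prod_e w e (g e)) * P (fun e => x e (g e))
      = K * \prod_e \sum_j w e j * x e j ^+ l.
Proof.
move=> [s sd Ps].
exists (\sum_(t <- s) t.1 * (t.2 == [ffun=> l])%:R) => J x w w0.
rewrite (eq_bigr _ (fun g _ => etrans (congr1 _ (Ps _)) (mulr_sumr _ _ _ _))).
rewrite exchange_big mulr_suml big_seq [RHS]big_seq.
apply: eq_bigr => t ts /=.
transitivity (t.1 * \prod_e \sum_j w e j * x e j ^+ t.2 e).
  rewrite bigA_distr_bigA mulr_sumr; apply: eq_bigr => g _.
  by rewrite big_split /= mulrCA.
rewrite -mulrA; congr (_ * _).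
have [->|tl] := eqVneq t.2 [ffun=> l].
  by rewrite mul1r; apply: eq_bigr => e _; apply: eq_bigr => j _; rewrite ffunE.
rewrite mul0r.
have [/existsP[e te]|] := boolP [exists e, t.2 e < l]%N.
  by rewrite (bigD1 e) //= w0 // mul0r.
rewrite negb_exists => /forallP tge; case/eqP: tl; apply/ffunP => e.
rewrite ffunE; apply/eqP; rewrite eq_sym; move: e.
have le_lt e : predT e -> (l <= t.2 e ?= iff (l == t.2 e))%N.
  by split=> //; rewrite leqNgt tge.
have := leqif_sum le_lt.
rewrite sum_nat_const (eqP (allP sd _ ts)) => -[_].
by rewrite eqxx => /esym/forallP tE e; have := tE e.
Qed.

(** The weights form the last column of the inverse of the Vandermonde matrix of the nodes; they
    extract the coefficient of degree [l]. *)
Lemma exists_interpolation_weights (F : fieldType) (l : nat)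
    (x : 'I_l.+1 -> F) : injective x ->
  exists w : 'I_l.+1 -> F,
    forall m, (m <= l)%N -> \sum_j w j * x j ^+ m = (m == l)%:R.
Proof.
move=> x_inj; pose V := Vandermonde l.+1 (\row_j x j).
have Vu : V \in unitmx.
  rewrite unitmxE det_Vandermonde unitfE.
  apply/prodf_neq0 => i _; apply/prodf_neq0 => j ij.
  rewrite !mxE subr_eq0 (inj_eq x_inj); apply: contraTneq ij => ->.
  by rewrite ltnn.
pose w := invmx V *m delta_mx ord_max (0 : 'I_1).
exists (fun j => w j 0) => m ml.
have := mulKVmx Vu (delta_mx ord_max (0 : 'I_1)).
move/matrixP/(_ (inord m) 0); rewrite !mxE eqxx andbT.
rewrite -val_eqE /= inordK // => <-.
by apply: eq_bigr => j _; rewrite !mxE mulrC inordK.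
Qed.

(** The constant [K] of [homogeneous_weighted_sum] does not depend on the nodes. The nonzero sum at
    [x0] gives [K != 0]; with interpolation weights at [x] the sum is [K] itself, so [P] cannot
    vanish on the whole grid. *)
Lemma nullstellensatz_transfer (F : fieldType) (E : finType) (l : nat)
    (P : (E -> F) -> F) (J : finType) (x0 w0 : E -> J -> F)
    (x : E -> 'I_l.+1 -> F) :
  homogeneous (#|E| * l) P ->
  (forall e m, (m < l)%N -> \sum_j w0 e j * x0 e j ^+ m = 0) ->
  \sum_(g : {ffun E -> J}) (\prod_e w0 e (g e)) * P (fun e => x0 e (g e)) != 0 ->
  (forall e, injective (x e)) ->
  exists g : {ffun E -> 'I_l.+1}, P (fun e => x e (g e)) != 0.
Proof.
move=> Phom w0P; have [K KP] := homogeneous_weighted_sum Phom.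
rewrite (KP J x0 w0 w0P) mulf_eq0 negb_or => /andP[K0 _] x_inj.
have [W WP] : exists W : {ffun E -> {ffun 'I_l.+1 -> F}},
    forall e m, (m <= l)%N -> \sum_j W e j * x e j ^+ m = (m == l)%:R.
  have ex e : exists w : {ffun 'I_l.+1 -> F}, [forall m : 'I_l.+1,
      \sum_j w j * x e j ^+ m == ((m : nat) == l)%:R].
    have [w wP] := exists_interpolation_weights (@x_inj e).
    exists (finfun w); apply/forallP => m; apply/eqP.
    rewrite -wP; last by rewrite -ltnS.
    by apply: eq_bigr => j _; rewrite ffunE.
  exists [ffun e => xchoose (ex e)] => e m ml.
  have /forallP/(_ (inord m))/eqP := xchooseP (ex e).
  by rewrite ffunE inordK.
apply/existsP; rewrite -[X in is_true X]negbK negb_exists.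
apply: contra_neqN K0 => /forallP P0.
have W0 e m : (m < l)%N -> \sum_j W e j * x e j ^+ m = 0.
  by move=> ml; rewrite WP 1?ltnW // ltn_eqF.
have := KP _ x (fun e => W e) W0.
rewrite [X in _ * X]big1 => [|e _]; last by rewrite WP // eqxx.
rewrite mulr1 => <-; apply: big1 => g _.
by have := P0 g; rewrite negbK => /eqP->; rewrite mulr0.
Qed.

(** * The transfer-matrix method *)

Definition ffun_cons (T : finType) (n : nat) (x : T) (g : {ffun 'I_n -> T}) :
    {ffun 'I_n.+1 -> T} :=
  [ffun i => oapp g x (unlift ord0 i)].

Lemma big_ffun_recl (R : Type) (idx : R) (op : Monoid.com_law idx) (T : finType)
    (n : nat) (G : {ffun 'I_n.+1 -> T} -> R) :
  \big[op/idx]_f G f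
    = \big[op/idx]_x \big[op/idx]_(g : {ffun 'I_n -> T}) G (ffun_cons x g).
Proof.
rewrite pair_big /=.
apply: (reindex (fun p : T * {ffun 'I_n -> T} => ffun_cons p.1 p.2)).
exists (fun f : {ffun 'I_n.+1 -> T} => (f ord0, [ffun i => f (lift ord0 i)])).
  move=> [x g] _ /=; rewrite ffunE unlift_none; congr (_, _).
  by apply/ffunP => i; rewrite !ffunE liftK.
move=> f _ /=; apply/ffunP => i; rewrite ffunE.
by case: unliftP => [j|] ->; rewrite /= ?ffunE.
Qed.

Fixpoint kernel_pow (R : pzSemiRingType) (S : finType) (K : S -> S -> R) (n : nat)
    (a b : S) : R :=
  if n is n'.+1 then \sum_c K a c * kernel_pow K n' c b else (a == b)%:R.

(** The state is the output of the preceding choice, or [a] at the start; the default of [oapp] is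
    reached only for [i > n]. *)
Definition state_before (S H : Type) (o : H -> S) (n : nat) (a : S) (f : 'I_n -> H)
    (i : nat) : S :=
  if i is i'.+1 then oapp (o \o f) a (insub i') else a.
Arguments state_before : simpl never.

Lemma state_before_cons (S : Type) (H : finType) (o : H -> S) (n : nat) (a : S) (x : H)
    (g : {ffun 'I_n -> H}) (i : nat) : (i <= n)%N ->
  state_before o a (ffun_cons x g) i.+1 = state_before o (o x) g i.
Proof.
move=> le_in; rewrite /state_before insubT /=; case: i le_in => [|i] le_in.
  by rewrite ffunE (_ : Sub _ _ = ord0) ?unlift_none //; apply: val_inj.
rewrite insubT /= ffunE.
rewrite (_ : Sub _ _ = lift ord0 (Ordinal le_in)) ?liftK //=; exact: val_inj.
Qed.

(** By induction on [n]: the first choice is split off and grouped by the state it leads to. *)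
Lemma path_sum (R : comPzSemiRingType) (S H : finType) (o : H -> S)
    (Psi : S -> H -> R) (n : nat) (a b : S) :
  \sum_(f : {ffun 'I_n -> H})
      (\prod_(i < n) Psi (state_before o a f i) (f i)) * (state_before o a f n == b)%:R
    = kernel_pow (fun a c => \sum_(h | o h == c) Psi a h) n a b.
Proof.
elim: n a => [|n IHn] a.
  rewrite (eq_bigr (fun=> (a == b)%:R)) => [|f _]; last by rewrite big_ord0 mul1r.
  by rewrite big_const card_ffun card_ord expn0 /= addr0.
rewrite big_ffun_recl /= (partition_big o predT) //=; apply: eq_bigr => c _.
rewrite mulr_suml; apply: eq_bigr => h /eqP<-.
rewrite -IHn mulr_sumr; apply: eq_bigr => f _.
rewrite big_ord_recl /= ffunE unlift_none /= state_before_cons // -mulrA.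
congr (_ * (_ * _)); apply: eq_bigr => i _.
by rewrite state_before_cons ?ffunE ?liftK // ltnW.
Qed.

(** The start depends on the last state of [f], so all final states [b] are summed over; the
    indicator in [path_sum] keeps only [b = o (f ord_max)]. *)
Lemma cycle_sum (R : comPzSemiRingType) (S H : finType) (o : H -> S) (s : S -> S)
    (Psi : S -> H -> R) (n : nat) :
  \sum_(f : {ffun 'I_n.+1 -> H})
      \prod_(i < n.+1) Psi (state_before o (s (o (f ord_max))) f i) (f i)
    = \sum_b kernel_pow (fun a c => \sum_(h | o h == c) Psi a h) n.+1 (s b) b.
Proof.
under [RHS]eq_bigr do rewrite -path_sum.
rewrite exchange_big; apply: eq_bigr => f _ /=.
have last a : state_before o a f n.+1 = o (f ord_max).
  by rewrite /state_before (insubT (fun i => i < n.+1)%N (ltnSn n)) /=; congr (o (f _)); apply: val_inj.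
rewrite (bigD1 (o (f ord_max))) //= last eqxx mulr1 [X in _ + X]big1 ?addr0 // => b bf.
by rewrite last eq_sym (negbTE bf) mulr0.
Qed.

Lemma kernel_powD (R : pzSemiRingType) (S : finType) (K : S -> S -> R) (m n : nat)
    (a b : S) :
  kernel_pow K (m + n) a b = \sum_c kernel_pow K m a c * kernel_pow K n c b.
Proof.
elim: m a => [|m IHm] a /=.
  rewrite (bigD1 a) //= eqxx mul1r big1 ?addr0 // => c ca.
  by rewrite eq_sym (negbTE ca) mul0r.
under eq_bigr do rewrite IHm mulr_sumr.
rewrite exchange_big; apply: eq_bigr => c _ /=.
by rewrite mulr_suml; apply: eq_bigr => d _; rewrite mulrA.
Qed.

Lemma kernel_pow_cube (R : pzRingType) (S : finType) (K : S -> S -> R) (c : R) :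
  (forall a b, kernel_pow K 3 a b = c * K a b) ->
  forall n a b, kernel_pow K n.+3 a b = c * kernel_pow K n.+1 a b.
Proof.
move=> K3 n a b; rewrite -add3n kernel_powD /= mulr_sumr.
by apply: eq_bigr => d _; rewrite mulrA -K3.
Qed.

(** * The transfer matrix of one column *)

(* Proportional to the Lagrange weights of the nodes 0, 1, 2: they annihilate 1 and x. *)
Definition weight (x : 'I_3) : int := if x == 1%N :> nat then - 2%:Z else 1.

(** The sign of [(x, y, z)] as a permutation of 0, 1, 2: the even ones are the cyclic shifts,
    recognised by [y = x + 1] modulo 3. *)
Definition sgn3 (x y z : nat) : int :=
  if uniq [:: x; y; z] then (if (y == x.+1 %% 3)%N then 1 else -1) else 0.

Definition triple (T : Type) : Type := (T * T * T)%type.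

Definition prod3 (T : Type) (F : T -> int) (p : triple T) : int :=
  F p.1.1 * F p.1.2 * F p.2.

(* In a column, [h = (b, s, t)] lists the colours, row by row, of the outer edges leaving it, of
   its spokes and of its inner edges; [a] those of the outer edges entering it. *)
Definition column_weight (a : triple 'I_3) (h : triple (triple 'I_3)) : int :=
  let: (b, s, t) := h in
  prod3 (prod3 weight) h *
  (sgn3 s.1.1 b.1.1 a.1.1 * sgn3 s.1.2 b.1.2 a.1.2 * sgn3 s.2 b.2 a.2) *
  (sgn3 s.1.1 t.1.1 t.2 * sgn3 s.1.2 t.1.2 t.1.1 * sgn3 s.2 t.2 t.1.2).

Definition transfer (a b : triple 'I_3) : int :=
  \sum_(h | h.1.1 == b) column_weight a h.

Definition colours3 : seq (triple 'I_3) :=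
  let c : seq 'I_3 := [:: @Ordinal 3 0 isT; @Ordinal 3 1 isT; @Ordinal 3 2 isT] in
  [seq (x, z) | x <- [seq (x, y) | x <- c, y <- c], z <- c].

(* Closed form of [transfer a b]: a proper colouring has all three colours on the spokes, and the
   spokes determine the colours of the inner triangle. *)
Definition transfer_entry (a b : triple 'I_3) : int :=
  let x := (3 - (a.1.1 + b.1.1))%N in
  let y := (3 - (a.1.2 + b.1.2))%N in
  let z := (3 - (a.2 + b.2))%N in
  - 4%:Z * prod3 weight b * sgn3 x y z *
  (sgn3 x b.1.1 a.1.1 * sgn3 y b.1.2 a.1.2 * sgn3 z b.2 a.2).

Lemma mem_colours3 (a : triple 'I_3) : a \in colours3.
Proof. by case: a => [[[[|[|[|?]]] ?] [[|[|[|?]]] ?]] [[|[|[|?]]] ?]]. Qed.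

Lemma big_colours3 (F : triple 'I_3 -> int) : \sum_a F a = \sum_(a <- colours3) F a.
Proof.
apply: perm_big; apply: uniq_perm => [||a] //; first exact: index_enum_uniq.
by rewrite mem_index_enum mem_colours3.
Qed.

Lemma sum_colours3 (F : triple 'I_3 -> int) :
  \sum_a F a = foldr (fun a r => F a + r) 0 colours3.
Proof. by rewrite big_colours3 unlock. Qed.

Lemma sum_support (F G : triple 'I_3 -> int) :
  \sum_a F a * G a = \sum_(a <- [seq a <- colours3 | F a != 0]) F a * G a.
Proof.
rewrite big_filter [RHS]big_mkcond /= -big_colours3; apply: eq_bigr => a _.
by case: eqP => // ->; rewrite mul0r.
Qed.

Definition triangle_weight (s : triple 'I_3) : int :=
  \sum_(t : triple 'I_3) prod3 weight t *
    (sgn3 s.1.1 t.1.1 t.2 * sgn3 s.1.2 t.1.2 t.1.1 * sgn3 s.2 t.2 t.1.2).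

(** Each spoke must get the colour of the inner edge opposite to its end, so at most one [t]
    contributes. *)
Lemma triangle_weightE (s : triple 'I_3) :
  triangle_weight s = 2%:Z * sgn3 s.1.1 s.1.2 s.2.
Proof.
rewrite /triangle_weight sum_colours3; apply/eqP.
move: s (mem_colours3 s); apply/allP; vm_compute; reflexivity.
Qed.

(** Summing out the inner triangle leaves [2] times the sign of the spokes; when this is nonzero the
    spokes have weight [-2], whence the factor [-4]. *)
Lemma transferE (a b : triple 'I_3) : transfer a b = transfer_entry a b.
Proof.
rewrite /transfer (reindex_onto (fun p => (b, p.1, p.2)) (fun h => (h.1.2, h.2)))
  => [|[[b' s] t] /eqP /= <- //].
rewrite (eq_bigl predT) => [|[s t]]; last by rewrite /= !eqxx.
rewrite -(pair_bigA _ (fun s t => column_weight a (b, s, t))) /=.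
pose F s := prod3 weight b * prod3 weight s *
  (sgn3 s.1.1 b.1.1 a.1.1 * sgn3 s.1.2 b.1.2 a.1.2 * sgn3 s.2 b.2 a.2).
transitivity (\sum_s F s * (2%:Z * sgn3 s.1.1 s.1.2 s.2)).
  apply: eq_bigr => s _; rewrite -triangle_weightE mulr_sumr; apply: eq_bigr => t _.
  by rewrite /F /column_weight /prod3 /=; ring.
rewrite (eq_bigr (fun s : triple 'I_3 => sgn3 s.1.1 s.1.2 s.2 * (2%:Z * F s))) => [|s _];
  last by rewrite mulrCA mulrA mulrC.
rewrite (sum_support (fun s : triple 'I_3 => sgn3 s.1.1 s.1.2 s.2)) unlock; apply/eqP.
(* The support is an argument of [check], so that [vm_compute] evaluates it only once. *)
pose check (r : seq (triple 'I_3)) := all (fun a : triple 'I_3 => all (fun b : triple 'I_3 =>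
  foldr (fun (s : triple 'I_3) z => sgn3 s.1.1 s.1.2 s.2 *
    (2%:Z * (prod3 weight b * prod3 weight s *
    (sgn3 s.1.1 b.1.1 a.1.1 * sgn3 s.1.2 b.1.2 a.1.2 * sgn3 s.2 b.2 a.2))) + z) 0 r
  == transfer_entry a b) colours3) colours3.
have: check [seq s : triple 'I_3 <- colours3 | sgn3 s.1.1 s.1.2 s.2 != 0] by vm_compute.
by move=> /allP/(_ a (mem_colours3 a))/allP/(_ b (mem_colours3 b)).
Qed.

(** Sparse rows keep the computation of the cube small. *)
Definition transfer_row (a : triple 'I_3) : seq (triple 'I_3 * int) :=
  [seq (c, transfer_entry a c) | c <- colours3 & transfer_entry a c != 0].

Lemma sum_transfer_row (a : triple 'I_3) (G : triple 'I_3 -> int) :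
  \sum_c transfer_entry a c * G c = \sum_(p <- transfer_row a) p.2 * G p.1.
Proof. by rewrite sum_support big_map. Qed.

Lemma transfer_cube (a b : triple 'I_3) :
  kernel_pow transfer 3 a b = - 192%:Z * transfer a b.
Proof.
transitivity (\sum_c transfer_entry a c * \sum_d transfer_entry c d * transfer_entry d b).
  rewrite /=; apply: eq_bigr => c _; rewrite transferE; congr (_ * _).
  apply: eq_bigr => d _; rewrite transferE; congr (_ * _).
  rewrite (bigD1 b) //= eqxx mulr1 big1 ?addr0 ?transferE // => e eb.
  by rewrite (negbTE eb) mulr0.
(* The two-step paths from [a], as pairs of end point and weight, with equal end points left
   unmerged. *)
pose row2 a := [seq (q.1, p.2 * q.2) |
  p : triple 'I_3 * int <- transfer_row a, q : triple 'I_3 * int <- transfer_row p.1].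
transitivity (\sum_(p <- row2 a) p.2 * transfer_entry p.1 b).
  rewrite big_allpairs_dep sum_transfer_row; apply: eq_bigr => p _.
  rewrite sum_transfer_row mulr_sumr; apply: eq_bigr => q _.
  by rewrite mulrA.
rewrite transferE unlock; apply/eqP.
pose check (a : triple 'I_3) (r : seq (triple 'I_3 * int)) := all (fun b =>
  foldr (fun p z => p.2 * transfer_entry p.1 b + z) 0 r
  == - 192%:Z * transfer_entry a b) colours3.
have: all (fun a => check a (row2 a)) colours3 by vm_compute.
by move=> /allP/(_ a (mem_colours3 a))/allP/(_ b (mem_colours3 b)).
Qed.

Lemma transfer_trace_neq0 (n : nat) :
  \sum_b kernel_pow transfer n.+1 (b.2, b.1.1, b.1.2) b != 0.
Proof.
(* Each increment of [m] multiplies the trace by [-192]; the parity of [n] leaves the powers 1 and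
   2. *)
have [m ->] : exists m, n = (m.*2 + odd n)%N by exists n./2; rewrite addnC odd_double_half.
elim: m => [|m IHm]; last first.
  under eq_bigr do rewrite doubleS !addSn (kernel_pow_cube transfer_cube).
  by rewrite -mulr_sumr mulf_neq0.
have kernel_pow1 a b : kernel_pow transfer 1 a b = transfer_entry a b.
  rewrite /= (bigD1 b) //= eqxx mulr1 big1 ?addr0 ?transferE // => c cb.
  by rewrite (negbTE cb) mulr0.
case: (odd n); rewrite double0 !add0n.
  under eq_bigr do rewrite (kernel_powD _ 1 1).
  under eq_bigr => b _ do under eq_bigr do rewrite !kernel_pow1.
  under eq_bigr do rewrite sum_colours3.
  by rewrite sum_colours3; vm_compute.
under eq_bigr do rewrite kernel_pow1.
by rewrite sum_colours3; vm_compute.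
Qed.

(** * Arranging the indices in 3 rows and k columns *)

Definition cell (k : nat) (r : 'I_3) (j : 'I_k) : 'I_(3 * k).
Proof. by exists (r * k + j)%N; case: r j => r r3 [j jk] /=; nia. Defined.

Lemma ordD_eq (n s : nat) (i j : 'I_n) :
  (i + s = j \/ i + s = j + n)%N -> ordD i s = j.
Proof.
by move=> ij; apply: val_inj => /=; case: ij => ->; rewrite ?modnDr modn_small.
Qed.

Definition pred3 (r : 'I_3) : 'I_3 := inord (if r : nat is r'.+1 then r' else 2).

Lemma pred3E (r : 'I_3) : pred3 r = (if r : nat is r'.+1 then r' else 2) :> nat.
Proof. by rewrite /pred3 inordK //; case: r => [[|[|[|r]]] ?]. Qed.

Lemma cell_sub_k (k : nat) (r : 'I_3) (j : 'I_k) :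
  ordD (cell r j) (3 * k - k) = cell (pred3 r) j.
Proof.
apply: ordD_eq; rewrite /= pred3E.
by case: r => [[|[|[|r]]] ?] //=; case: j => j jk /=; lia.
Qed.

Lemma cell_sub1 (k j : nat) (r : 'I_3) (jk : (j < k)%N) (j1k : (j.+1 < k)%N) :
  ordD (cell r (Ordinal j1k)) (3 * k - 1) = cell r (Ordinal jk).
Proof. by apply: ordD_eq => /=; lia. Qed.

Lemma cell0_sub1 (k : nat) (r : 'I_3) (k0 : (0 < k.+1)%N) :
  ordD (cell r (Ordinal k0)) (3 * k.+1 - 1) = cell (pred3 r) ord_max.
Proof.
apply: ordD_eq; rewrite /= pred3E.
by case: r => [[|[|[|r]]] ?] //=; lia.
Qed.

Definition row_of (k : nat) (i : 'I_(3 * k)) : 'I_3 := inord (i %/ k).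

Lemma col_of_subproof (k : nat) (i : 'I_(3 * k)) : (i %% k < k)%N.
Proof. by case: k i => [|k] [i ik] /=; rewrite ?ltn_mod. Qed.

Definition col_of (k : nat) (i : 'I_(3 * k)) : 'I_k := Ordinal (col_of_subproof i).

Lemma row_cell (k : nat) (r : 'I_3) (j : 'I_k) : row_of (cell r j) = r.
Proof.
have k_gt0 : (0 < k)%N by apply: leq_ltn_trans (ltn_ord j).
by rewrite /row_of /= divnMDl // divn_small // addn0 inord_val.
Qed.

Lemma col_cell (k : nat) (r : 'I_3) (j : 'I_k) : col_of (cell r j) = j.
Proof. by apply: val_inj; rewrite /= modnMDl modn_small. Qed.

Lemma cellK (k : nat) (i : 'I_(3 * k)) : cell (row_of i) (col_of i) = i.
Proof.
apply: val_inj; rewrite /= inordK; first by rewrite -divn_eq.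
by rewrite ltn_divLR //; case: k i => [|k] [i ik].
Qed.

Lemma prod_cell (R : comPzSemiRingType) (k : nat) (G : 'I_(3 * k) -> R) :
  \prod_i G i = \prod_(j < k) \prod_(r < 3) G (cell r j).
Proof.
rewrite pair_bigA /= (reindex (fun p : 'I_k * 'I_3 => cell p.2 p.1)) //=.
exists (fun i => (col_of i, row_of i)) => [[j r] _|i _] /=; last exact: cellK.
by rewrite row_cell col_cell.
Qed.

Lemma prod_pair (R : comPzSemiRingType) (A B : finType) (G : A * B -> R) :
  \prod_p G p = \prod_a \prod_b G (a, b).
Proof. by rewrite pair_bigA; apply: eq_bigr => -[]. Qed.

Lemma prod_option_bool (R : comPzSemiRingType) (G : option bool -> R) :
  \prod_t G t = G (Some false) * G None * G (Some true).
Proof.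
rewrite (perm_big [:: Some false; None; Some true]) /=.
  by rewrite !big_cons big_nil mulr1 mulrA.
by apply: uniq_perm => [||[[]|]] //; rewrite ?index_enum_uniq ?mem_index_enum.
Qed.

(** * The signed count as a twisted trace *)

Definition coord (T : Type) (r : nat) (p : triple T) : T :=
  match r with 0 => p.1.1 | 1 => p.1.2 | _ => p.2 end.

(** Follows the order outer, spoke, inner of a column [(b, s, t)]. *)
Definition coord_of_edge (t : option bool) : nat :=
  match t with Some false => 0 | None => 1 | Some true => 2 end.

Definition colouring_of (k : nat) (f : {ffun 'I_k -> triple (triple 'I_3)}) :
    {ffun edge_index (3 * k) -> 'I_3} :=
  [ffun e => coord (row_of e.2) (coord (coord_of_edge e.1) (f (col_of e.2)))].

Lemma colouring_ofE (k : nat) (f : {ffun 'I_k -> triple (triple 'I_3)}) t r j :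
  colouring_of f (t, cell r j) = coord r (coord (coord_of_edge t) (f j)).
Proof. by rewrite ffunE row_cell col_cell. Qed.

Lemma colouring_of_bij (k : nat) : bijective (@colouring_of k).
Proof.
pose col (g : {ffun edge_index (3 * k) -> 'I_3}) t j : triple 'I_3 :=
  (g (t, cell 0 j), g (t, cell 1 j), g (t, cell 2%:R j)).
exists (fun g => [ffun j => (col g (Some false) j, col g None j, col g (Some true) j)]).
  move=> f; apply/ffunP => j; rewrite ffunE /col !colouring_ofE /=.
  by case: (f j) => [[[[? ?] ?] [[? ?] ?]] [[? ?] ?]].
move=> g; apply/ffunP => -[t i]; rewrite -[i]cellK colouring_ofE !ffunE.
have -> : coord (coord_of_edge t) (col g (Some false) (col_of i), col g None (col_of i),
    col g (Some true) (col_of i)) = col g t (col_of i) by case: t => [[]|].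
(* Writes [r] as one of the constants 0, 1, 2 used by [col], so that [coord] computes. *)
move: (row_of i) => r; rewrite (_ : r = [:: 0; 1; 2%:R]`_r).
  by case: r => [[|[|[|r]]] ?].
by apply: val_inj; case: r => [[|[|[|r]]] ?].
Qed.

(* The outer edge leaving row [r] of the last column enters row [r + 1] of the first one, hence
   the shift of [b]. *)
Lemma signed_sumE (k : nat) :
  \sum_(g : {ffun edge_index (3 * k.+1) -> 'I_3}) (\prod_e weight (g e)) *
    \prod_(x : GPV (3 * k.+1)) sgn3 (g (None, x.2)) (g (Some x.1, x.2))
      (g (Some x.1, ordD x.2 (3 * k.+1 - step k.+1 x.1)))
  = \sum_b kernel_pow transfer k.+1 (b.2, b.1.1, b.1.2) b.
Proof.
rewrite (reindex (@colouring_of k.+1)); last exact/onW_bij/colouring_of_bij.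
rewrite -(cycle_sum (fun h : triple (triple 'I_3) => h.1.1)
  (fun b => (b.2, b.1.1, b.1.2)) column_weight).
apply: eq_bigr => f _.
rewrite !prod_pair prod_option_bool big_bool /=.
rewrite !prod_cell -!big_split /=; apply: eq_bigr => j _.
pose o (h : triple (triple 'I_3)) := h.1.1.
pose b := o (f ord_max).
pose a := state_before o (b.2, b.1.1, b.1.2) f j.
have outer r : colouring_of f (Some false, ordD (cell r j) (3 * k.+1 - 1)) = coord r a.
  rewrite {}/a; case: j => [[|j] jk].
    rewrite cell0_sub1 colouring_ofE pred3E.
    by case: r => [[|[|[|r]]] ?].
  rewrite (cell_sub1 _ (ltnW jk)) colouring_ofE.
  by rewrite /state_before /= (insubT (fun i => i < k.+1)%N (ltnW jk)).
rewrite -/a !big_ord_recl !big_ord0 !outer !cell_sub_k !colouring_ofE !pred3E /=.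
rewrite /column_weight /prod3.
by case: (f j) => [[[[? ?] ?] [[? ?] ?]] [[? ?] ?]] /=; ring.
Qed.

(** * Application of the Nullstellensatz to GP(3k,k) *)

Definition vandermonde3 (R : pzRingType) (x y z : R) : R := (x - y) * (x - z) * (y - z).

Lemma vandermonde3_neq0 (R : idomainType) (x y z : R) :
  (vandermonde3 x y z != 0) = uniq [:: x; y; z].
Proof. by rewrite !mulf_eq0 !subr_eq0 /= !inE !negb_or andbT. Qed.

(** Both sides are alternating, and [vandermonde3 0 1 2 = -2]. *)
Lemma vandermonde3_ord (x y z : 'I_3) :
  vandermonde3 (x%:R : rat) y%:R z%:R = - 2%:R * (sgn3 x y z)%:~R.
Proof.
by apply/eqP; case: x y z => [[|[|[|x]]] ?] // [[|[|[|y]]] ?] // [[|[|[|z]]] ?].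
Qed.

Definition vertex_polynomial (n k : nat) (x : edge_index n -> rat) (v : GPV n) : rat :=
  vandermonde3 (x (None, v.2)) (x (Some v.1, v.2))
    (x (Some v.1, ordD v.2 (n - step k v.1))).

Lemma vertex_polynomial_homogeneous (n k : nat) (v : GPV n) :
  homogeneous 3 (fun x => vertex_polynomial k x v).
Proof.
have hB e e' := homogeneousB (homogeneous_var rat e) (homogeneous_var rat e').
exact: homogeneousM (homogeneousM (hB _ _ _) (hB _ _ _)) (hB _ _ _).
Qed.

Lemma GP3k_3choosable (k : nat) : edge_choosable (GP (3 * k.+1) k.+1) 3.
Proof.
apply: GP_edge_choosable => [|L L3]; first by lia.
set n := (3 * k.+1)%N in L L3 *.
pose P (x : edge_index n -> rat) := \prod_v vertex_polynomial k.+1 x v.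
have Phom : homogeneous (#|edge_index n| * 2) P.
  (* Double counting of incidences: both sides are [6 * n]. *)
  rewrite (_ : (_ * 2 = #|GPV n| * 3)%N).
    exact/homogeneous_prod/vertex_polynomial_homogeneous.
  by rewrite !card_prod card_option card_bool card_ord; lia.
pose x0 (e : edge_index n) (j : 'I_3) : rat := j%:R.
pose w0 (e : edge_index n) (j : 'I_3) : rat := (weight j)%:~R.
(* The lists have size 3, so the default 0 is never reached. *)
pose x (e : edge_index n) (j : 'I_3) : rat := (nth 0%N (L e) j)%:R.
have [||e|g] := nullstellensatz_transfer (x0 := x0) (w0 := w0) (x := x) Phom.
- by move=> e [|[|m]] //; rewrite !big_ord_recl big_ord0.
(* Every vertex contributes a factor [-2] when its Vandermonde factor is replaced by [sgn3]. *)
- rewrite (_ : \sum_g _ = (- 2%:R) ^+ #|GPV n| *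
    (\sum_b kernel_pow transfer k.+1 (b.2, b.1.1, b.1.2) b)%:~R).
    rewrite mulf_neq0 ?expf_neq0 ?intr_eq0 //; exact: transfer_trace_neq0.
  rewrite -signed_sumE rmorph_sum mulr_sumr; apply: eq_bigr => g _.
  rewrite rmorphM !rmorph_prod mulrCA; congr (_ * _).
  rewrite -prodr_const -big_split; apply: eq_bigr => v _.
  exact: vandermonde3_ord.
- move=> i j /eqP; rewrite eqr_nat; have [Lu Ls] := L3 e.
  by rewrite nth_uniq ?Ls // => /eqP/val_inj.
move/prodf_neq0 => Pg; exists (fun e => nth 0%N (L e) (g e)); split=> [e|v].
  by have [_ Ls] := L3 e; rewrite mem_nth // Ls.
have := Pg v isT; rewrite vandermonde3_neq0 /=.
by rewrite !inE !eqr_nat.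
Qed.

Local Close Scope ring_scope.

Theorem theorem2 (k : nat) : 1 <= k ->
  exists l : nat, is_chromatic_index (GP (3 * k) k) l /\ is_choice_index (GP (3 * k) k) l.
Proof.
case: k => // k _; have ch3 := @GP3k_3choosable k.
have lower m : edge_colourable (GP (3 * k.+1) k.+1) m -> 3 <= m.
  by apply: GP_edge_colourable_ge3; lia.
exists 3; do 2!split=> //; first exact: edge_choosable_colourable.
by move=> m /edge_choosable_colourable/lower.
Qed.
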